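(* The time complexity of the KOCA algorithm is $O(k)$, where $k$ is the cluster radius.
   Context: The network is a multi-hop wireless sensor network of stationary nodes, modelled as a graph $G=(V,E)$; vertices are sensor nodes with unique IDs, and edges join nodes that can communicate directly over a bidirectional link. Communication is contention-free and error-free. The cluster radius $k\ge 1$ (an integer, the maximum number of hops between a node of a cluster and its cluster head) and the cluster head probability $p$ are given parameters of the algorithm. Let $t(k)$ be the time needed for a message to travel $k$ hops, and let $\delta$ be the maximum time needed for any node to finish bootstrapping and start the clustering process ($\delta$ is a constant independent of $k$). KOCA ($k$-hop Overlapping Clustering Algorithm) is the following randomized distributed algorithm. (1) Initialization. Each node becomes a cluster head (CH) with probability $p$; otherwise its status is non-cluster-head (NCH). A CH broadcasts an advertisement CH_AD carrying its ID and hop count $1$, and sets a timer JREQ_WAIT. An NCH node sets a timer CH_AD_WAIT; the maximum time an NCH node waits for CH_AD messages is $t(k)+\delta$. (2) Advertisement flooding. Each node keeps a table CH_table of the cluster heads known to it, with entries (cluster head ID, hop count, ID of the neighbor leading to that cluster head). On receiving a CH_AD of a cluster head (other than itself) that it has not yet heard of, a node adds an entry to CH_table and, if the hop count is less than $k$, rebroadcasts the message with hop count increased by one. Thus advertisements travel at most $k$ hops. (3) When CH_AD_WAIT fires at an NCH node: if its CH_table is empty, it changes its status to CH, broadcasts its own CH_AD with hop count $1$, and sets JREQ_WAIT; otherwise, for every cluster head in its CH_table it sends a join request (JREQ), which is forwarded to that cluster head through the neighbors recorded in the CH_table entries. (4) When JREQ_WAIT fires at a CH node, that node terminates the clustering phase.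 The timeout for JREQ messages is $c\,t(k)+\delta$, where $c$ is a constant that depends on the MAC protocol, the node density and the value of $p$. *)

(* Defs.v *)
From HB Require Import structures.
From mathcomp Require Import all_boot all_order all_algebra.
From mathcomp Require Import all_classical all_reals all_analysis.

Set Implicit Arguments.
Unset Strict Implicit.
Unset Printing Implicit Defensive.

Import Order.TTheory GRing.Theory Num.Theory.
Import numFieldNormedType.Exports.

Local Open Scope classical_set_scope.
Local Open Scope ring_scope.

(* [latency u v] is the longest time a message can take over the link from [u]
   to [v]; [tau] bounds it independently of the network. *)
Record network (R : realType) (tau : R) := Network {
  node :> finType;
  link : rel node;
  link_sym : symmetric link;
  link_irr : irreflexive link;
  latency : node -> node -> R;
  latency_bound : forall u v, link u v -> 0 < latency u v <= tau }.

Section TravelTime.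
Variables (R : realType) (tau : R) (G : network tau).

Definition walk_latency (u : G) (w : seq G) : R :=
  \sum_(a <- zip (u :: w) w) latency a.1 a.2.

(* t(k): the time within which a message has travelled any k hops. Walks may
   backtrack, so this is nondecreasing in k and also covers shorter routes. *)
Definition travel_time (k : nat) : R :=
  \big[Num.max/0]_(u : G)
    \big[Num.max/0]_(w : k.-tuple G | path (@link _ _ G) u w) walk_latency u w.

End TravelTime.

(* A row of CH_table, with the time at which it was added. *)
Record entry (R : realType) (V : finType) := Entry {
  added : R;
  hops : nat;
  via : V }.

(* The random choices, the timing and the tables of a run. Time 0 is when the
   nodes are switched on; [boot v] is when [v] starts the clustering process.
   [ad_delay h u v]: delay over (u, v) of the CH_AD of [h] sent by [u].
   [jreq_delay n h u v]: delay over (u, v) of the JREQ of [n] to [h].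
   [table v h]: the row of the CH_table of [v] for [h], if [v] ever gets one. *)
Record history (R : realType) (V : finType) := History {
  boot : V -> R;
  elected : {set V};
  ad_delay : V -> V -> V -> R;
  jreq_delay : V -> V -> V -> V -> R;
  table : V -> V -> option (entry R V) }.

Section Koca.
Variables (R : realType) (p c delta tau : R) (k : nat).
Variables (G : network tau) (x : history R G).

Definition ch_ad_wait : R := travel_time G k + delta.
Definition jreq_wait : R := c * travel_time G k + delta.

(* When CH_AD_WAIT fires at [v], if [v] is not elected. *)
Definition ad_timeout (v : G) : R := boot x v + ch_ad_wait.

(* A message received at the very instant a timer fires is handled first. *)
Definition knows (v h : G) (s : R) : bool :=
  if table x v h is Some e then added e <= s else false.

Definition head_since (v : G) : option R :=
  if v \in elected x then Some (boot x v)
  else if [exists h, knows v h (ad_timeout v)] then None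
  else Some (ad_timeout v).

(* A cluster head takes no further part once JREQ_WAIT has fired. *)
Definition active (v : G) (s : R) : bool :=
  if head_since v is Some s0 then s <= s0 + jreq_wait else true.

(* Time and hop count of the (only) broadcast by [u] of the CH_AD of [h]. *)
Definition broadcast (h u : G) : option (R * nat) :=
  if u == h then omap (fun s => (s, 1%N)) (head_since h)
  else if table x u h is Some e then
    if (hops e < k)%N then Some (added e, (hops e).+1) else None
  else None.

(* [v] receives a CH_AD of [h] that would make [e] the row for [h]. A message
   reaching a node that is still bootstrapping is handled when it has booted. *)
Definition ad_received (v h : G) (e : entry R G) : bool :=
  if broadcast h (via e) is Some (s, n) then
    [&& v != h, link (via e) v, hops e == n,
        added e == Num.max (boot x v) (s + ad_delay x h (via e) v)
      & active v (added e)]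
  else false.

(* [jreq_at n h u s]: at time [s], [u] sends on or, if [u = h], gets the JREQ
   of [n] to [h]. *)
Inductive jreq_at (n h : G) : G -> R -> Prop :=
| JreqSent of n \notin elected x & knows n h (ad_timeout n) :
    jreq_at n h n (ad_timeout n)
| JreqRelayed u s e of jreq_at n h u s & table x u h = Some e
    & active (via e) (s + jreq_delay x n h u (via e)) :
    jreq_at n h (via e) (s + jreq_delay x n h u (via e)).

(* Each node is elected independently with probability [p]. *)
Definition election_prob (A : {set G}) : R :=
  \prod_(v : G) (if v \in A then p else 1 - p).

Record koca_run : Prop := KocaRun {
  run_boot : forall v, 0 <= boot x v <= delta;
  run_elected : 0 < election_prob (elected x);
  run_ad_delay : forall h u v, link u v ->
    0 < ad_delay x h u v <= latency u v;
  run_jreq_delay : forall n h u v, link u v ->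
    0 < jreq_delay x n h u v <= latency u v;
  run_table_some : forall v h e, table x v h = Some e ->
    ad_received v h e /\
    (forall e', ad_received v h e' -> added e <= added e');
  run_table_none : forall v h, table x v h = None ->
    forall e, ~~ ad_received v h e }.

Inductive event : R -> Prop :=
| Booted v : event (boot x v)
| AdReceived v h e of ad_received v h e : event (added e)
| AdWaitFired v of v \notin elected x : event (ad_timeout v)
| JreqHandled n h u s of jreq_at n h u s : event s
| JreqWaitFired v s of head_since v = Some s : event (s + jreq_wait).

Definition completion_time : \bar R := ereal_sup [set s%:E | s in event].

End Koca.

(* Worst case over all networks with hop latency at most [tau], all outcomes of
   the election of nonzero probability, and all timings. *)
Definition koca_time (R : realType) (p c delta tau : R) (k : nat) : \bar R :=
  ereal_sup [set T | exists (G : network tau) (x : history R G),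
    koca_run p c delta k x /\ T = completion_time c delta k x].

(* Main.v *)
(** A message over one link takes at most [tau], so [t(k) <= tau * k]. Hop
    counts increase by one along the links through which table rows were
    learnt, and never exceed [k]. Hence an advertisement is delivered within
    [tau * k] of the moment its cluster head arises, and a join request, which
    moves back along the same rows, within [tau * k] of being sent. All timers
    fire a time linear in [t(k)] after they are set, so every event occurs by
    time [3 delta + (2 + c) tau k]. *)
Require Import Defs.
From HB Require Import structures.
From mathcomp Require Import all_boot all_order all_algebra.
From mathcomp Require Import all_classical all_reals all_analysis.
From mathcomp Require Import lra.

Set Implicit Arguments.
Unset Strict Implicit.
Unset Printing Implicit Defensive.

Import Order.TTheory GRing.Theory Num.Theory.
Import numFieldNormedType.Exports.

Local Open Scope classical_set_scope.
Local Open Scope ring_scope.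

Section TravelTimeBounds.
Variables (R : realType) (tau : R) (G : network tau).

Lemma walk_latency_le (u : G) (w : seq G) :
  path (@link _ _ G) u w -> walk_latency u w <= tau * (size w)%:R.
Proof.
rewrite /walk_latency; elim: w u => [|v w IHw] u /=.
  by rewrite big_nil mulr0.
case/andP=> uv vw; rewrite big_cons /= -natr1 mulrDr mulr1 addrC.
by apply: lerD; [exact: IHw | case/andP: (latency_bound uv)].
Qed.

Lemma travel_time_le (k : nat) : 0 <= tau -> travel_time G k <= tau * k%:R.
Proof.
(* [tk0] takes care of the default [0] of both maxima, the value they have when [G] contains no walk
   with [k] hops. *)
move=> tau0; have tk0 : 0 <= tau * k%:R by rewrite mulr_ge0.
apply/bigmax_leP; split=> // u _; apply/bigmax_leP; split=> // w uw.
by rewrite (le_trans (walk_latency_le uw)) // size_tuple.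
Qed.

End TravelTimeBounds.

Section RunBounds.
Variables (R : realType) (p c delta tau : R) (k : nat).
Variables (G : network tau) (x : history R G).
Hypotheses (c0 : 0 <= c) (delta0 : 0 <= delta) (tau0 : 0 <= tau).
Hypotheses (k0 : (0 < k)%N) (run : koca_run p c delta k x).

(** Latest time at which [CH_AD_WAIT] can fire, and hence at which a cluster head can arise: booting
    by [delta], then a wait of at most [tau * k%:R + delta]. *)
Let T : R := 2 * delta + tau * k%:R.

Lemma boot_le v : boot x v <= delta.
Proof. by case/andP: (run_boot run v). Qed.

Lemma ad_timeout_le v : ad_timeout delta k x v <= T.
Proof.
rewrite /ad_timeout /ch_ad_wait /T.
have := boot_le v; have := travel_time_le G k tau0; lra.
Qed.

Lemma head_since_le v s : head_since delta k x v = Some s -> s <= T.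
Proof.
rewrite /head_since; case: ifP => _; last first.
  by case: ifP => // _ [<-]; exact: ad_timeout_le.
move=> [<-]; have := boot_le v; have : 0 <= tau * k%:R by rewrite mulr_ge0.
by move: delta0; rewrite /T; lra.
Qed.

(** The sender is either the cluster head, whose broadcast has hop count 1, or a relay, whose own
    row is one hop shorter. The maximum with [delta] covers messages held back until the receiver
    has booted. *)
Lemma ad_receivedP v h e : ad_received c delta k x v h e ->
  [/\ (hops e <= k)%N, link (via e) v &
  (via e == h) && (added e <= T + tau * (hops e)%:R) \/
  exists e', [/\ table x (via e) h = Some e', hops e = (hops e').+1 &
    added e <= Num.max delta (added e' + tau)]].
Proof.
rewrite /ad_received.
case E: (broadcast _ _ _ _ _) => [[s n]|] //.
case/and5P=> _ lk /eqP hn /eqP -> _.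
have /andP[_ dle] := run_ad_delay run h lk.
have /andP[_ lle] := latency_bound lk.
have d0 := delta0; have t0 := tau0; have bv := boot_le v.
move: E; rewrite /broadcast; case: eqP => [vh|_].
  case E: (head_since _ _ _ _) => [s'|] //= [ss n1].
  have hs := head_since_le E.
  split; rewrite ?hn -?n1 //; left; rewrite mulr1 ge_max /=.
  have : 0 <= tau * k%:R by rewrite mulr_ge0.
  by move=> ?; apply/andP; split; move: hs; rewrite -?ss /T; lra.
case: (table x (via e) h) => [e'|] //; case: ifP => // ek [se en].
split; rewrite ?hn -?en //; right; exists e'; split=> //.
rewrite ge_max !le_max bv /= -se.
by apply/orP; right; lra.
Qed.

(** Induction on the hop count, following the rows back to the cluster head. *)
Lemma added_le v h e : ad_received c delta k x v h e ->
  added e <= T + tau * (hops e)%:R.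
Proof.
have [n hn] := ubnP (hops e); elim: n v e hn => // n IHn v e hn.
case/ad_receivedP=> _ _ [/andP[_ //]|[e' [te' he ae]]].
have [re' _] := run_table_some run te'.
have := IHn _ e' _ re'; rewrite -ltnS -he => /(_ hn) ae'.
(* Waiting for a receiver to boot costs nothing extra, as [delta <= T]. *)
apply: (le_trans ae); rewrite he -natr1 ge_max.
have : 0 <= tau * (hops e')%:R by rewrite mulr_ge0.
have : 0 <= tau * k%:R by rewrite mulr_ge0.
by move=> ? ?; apply/andP; split; move: delta0 tau0 ae'; rewrite /T; lra.
Qed.

(* The remaining hop count is the potential of a request under way: each relay
   decreases it by one, at a cost of at most [tau]. *)
Lemma jreq_at_le n h u s : jreq_at c delta k x n h u s ->
  (u == h) && (s <= T + tau * k%:R) \/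
  exists2 e, table x u h = Some e & s + tau * (hops e)%:R <= T + tau * k%:R.
Proof.
elim=> {u s} [_|u s e _ IH tu _].
  rewrite /knows; case E: (table x n h) => [e|] // _; right; exists e => //.
  have [/ad_receivedP[ek _ _] _] := run_table_some run E.
  by apply: lerD; rewrite ?ad_timeout_le // ler_wpM2l // ler_nat.
have [re _] := run_table_some run tu.
have {IH} IH : s + tau * (hops e)%:R <= T + tau * k%:R.
  (* A request that has reached [h] is not relayed: [ad_received] excludes a row of [h] for
     itself. *)
  case: IH => [/andP[/eqP uh _]|[e']]; last by rewrite tu => -[<-].
  by move: re; rewrite uh /ad_received eqxx /=; case: broadcast => // -[].
have [_ lk hop] := ad_receivedP re.
(* Requests cross links against the direction of the advertisement. *)
have lk' : link u (via e) by rewrite link_sym.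
have /andP[_ dle] := run_jreq_delay run n h lk'.
have /andP[_ lle] := latency_bound lk'.
case: hop => [/andP[vh _]|[e' [te' he _]]].
  left; rewrite vh /=.
  (* The last hop is paid for by a row of hop count 1, as it was learnt from [h] directly. *)
  suff : tau <= tau * (hops e)%:R by lra.
  rewrite ler_peMr // ler1n.
  move: re; rewrite /ad_received /broadcast vh.
  by case: head_since => //= s' /and5P[_ _ /eqP ->].
right; exists e' => //; move: IH; rewrite he -natr1; lra.
Qed.

(** After [T], messages need at most [tau * k%:R] more, while [JREQ_WAIT] adds at most
    [c * tau * k%:R + delta]; the bound dominates both. *)
Lemma event_le s : event c delta k x s ->
  s <= 3 * delta + (2 + c) * tau * k%:R.
Proof.
have d0 := delta0; have tk0 : 0 <= tau * k%:R by rewrite mulr_ge0.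
have ctk0 : 0 <= c * (tau * k%:R) by rewrite mulr_ge0.
case=> {s} [v|v h e re|v _|n h u s js|v s hs].
- by have := boot_le v; lra.
- have [ek _ _] := ad_receivedP re.
  have : tau * (hops e)%:R <= tau * k%:R by rewrite ler_wpM2l // ler_nat.
  by have := added_le re; rewrite /T; lra.
- by have := ad_timeout_le v; rewrite /T; lra.
- have : s <= T + tau * k%:R; last by rewrite /T; lra.
  case: (jreq_at_le js) => [/andP[]//|[e _]].
  have : 0 <= tau * (hops e)%:R by rewrite mulr_ge0.
  lra.
- have := head_since_le hs.
  have : c * travel_time G k <= c * (tau * k%:R).
    by rewrite ler_wpM2l // travel_time_le.
  by rewrite /jreq_wait /T; lra.
Qed.

End RunBounds.

Section IsolatedNode.
Variables (R : realType) (p tau : R).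

Lemma isolated_latency_bound (u v : unit) : false -> 0 < (0 : R) <= tau.
Proof. by []. Qed.

Definition isolated_node : network tau :=
  @Network R tau unit (fun _ _ => false) (fun _ _ => erefl) (fun _ => erefl)
    (fun _ _ => 0) isolated_latency_bound.

(** Electing the node exactly when [0 < p] keeps the probability of this outcome positive, even for
    [p = 0]. *)
Definition isolated_history : history R isolated_node :=
  @History R isolated_node (fun _ => 0) [set _ | 0 < p]%SET (fun _ _ _ => 0)
    (fun _ _ _ _ => 0) (fun _ _ => None).

Lemma isolated_run (c delta : R) (k : nat) : 0 <= p <= 1 -> 0 <= delta ->
  koca_run p c delta k isolated_history.
Proof.
move=> /andP[p0 _] delta0; split=> //=.
- by move=> _; rewrite lexx.
- apply: prodr_gt0 => v _; rewrite inE; case: ifP => // /negbT.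
  by rewrite -leNgt => ple0; lra.
- move=> v h _ e; rewrite /ad_received.
  by case: broadcast => // -[s n]; rewrite andbF.
Qed.

End IsolatedNode.

Section KocaTime.
Variables (R : realType) (p c delta tau : R) (k : nat).
Hypotheses (hp : 0 <= p <= 1) (delta0 : 0 <= delta).

(** A supremum over no runs would be [-oo]; the isolated node supplies a run, with an event at time
    0. *)
Lemma koca_time_ge0 : (0 <= koca_time p c delta tau k)%E.
Proof.
apply: (@le_trans _ _ (completion_time c delta k (isolated_history p tau))).
  apply: ereal_sup_ubound; exists 0 => //.
  exact: (@Booted _ c delta tau k _ (isolated_history p tau) tt).
apply: ereal_sup_ubound; exists (isolated_node tau), (isolated_history p tau).
by split=> //; exact: isolated_run.
Qed.

Lemma koca_time_le : 0 <= c -> 0 <= tau -> (0 < k)%N ->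
  (koca_time p c delta tau k <= (3 * delta + (2 + c) * tau * k%:R)%:E)%E.
Proof.
move=> c0 tau0 k0; apply: ge_ereal_sup => _ [G [x [run ->]]].
apply: ge_ereal_sup => _ [s es <-].
by rewrite lee_fin; exact: event_le run _ es.
Qed.

End KocaTime.

Theorem lemmaA1 (R : realType) (p c delta tau : R)
    (hp : 0 <= p <= 1) (hc : 0 < c) (hdelta : 0 <= delta) (htau : 0 < tau) :
  (forall k : nat, (0 < k)%N -> koca_time p c delta tau k \is a fin_num) /\
  (fun k : nat => fine (koca_time p c delta tau k) : R^o)
    =O_\oo (fun k : nat => k%:R : R^o).
Proof.
have fin k : (0 < k)%N -> koca_time p c delta tau k \is a fin_num.
  move=> k0; apply/fin_numPlt; rewrite (lt_le_trans (ltNyr 0)) ?koca_time_ge0 //.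
  by rewrite (le_lt_trans (koca_time_le _ hdelta (ltW hc) (ltW htau) k0)) ?ltry.
(* The offset [3 * delta] does not grow with [k]; from [k = 1] on it is at most [3 * delta * k%:R],
   so it is merged into the constant. *)
split=> //; apply/eqO_exP; exists (3 * delta + (2 + c) * tau).
  by rewrite ltr_wpDl ?mulr_ge0 // mulr_gt0 // addr_gt0.
exists 1%N => // k /= k0.
rewrite ger0_norm ?fine_ge0 ?koca_time_ge0 // [`|k%:R|]ger0_norm //.
rewrite -lee_fin fineK ?fin //.
apply: (le_trans (koca_time_le _ hdelta (ltW hc) (ltW htau) k0)).
by rewrite lee_fin [leRHS]mulrDl lerD2r ler_peMr ?mulr_ge0 // ler1n.
Qed.
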